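(* Let $(L,\otimes,u)$ be a commutative unital quantale and let $(X,\langle\cdot\rangle)$ be an interpolative generalized $L$-closure space. Then the $L$-ordered set $(\mathfrak{C}(X),\mathrm{sub})$ of directed closed sets of $(X,\langle\cdot\rangle)$, with the inclusion $L$-order, is a continuous $L$-dcpo.
   Context: Quantale: $(L,\otimes,u)$ is a complete lattice with bottom $0$ and top $1$, with an associative commutative operation $\otimes$ with unit $u$, distributing over arbitrary joins; $\to$ is its residuation, i.e. $a\otimes b\le c\iff a\le b\to c$. An $L$-subset of $X$ is a map $A:X\to L$; $L^X$ is ordered pointwise; $(a\otimes A)(x)=a\otimes A(x)$. For $x\in X$, $u_x\in L^X$ is given by $u_x(x)=u$ and $u_x(y)=0$ for $y\ne x$. $\mathrm{sub}(A,B)=\bigwedge_{x\in X}(A(x)\to B(x))$ for $A,B\in L^X$. $L$-orders: an $L$-ordered set is a set $P$ with $e:P\times P\to L$ such that $e(x,x)\ge u$; $e(x,y)\otimes e(y,z)\le e(x,z)$; and $e(x,y)\wedge e(y,x)\ge u$ implies $x=y$. Any subset of $L^X$ is an $L$-ordered set under $\mathrm{sub}$. Write ${\downarrow}x(y)=e(y,x)$. An element $x_0$ is the supremum $\sqcup A$ of $A\in L^P$ if $e(x_0,y)=\bigwedge_{x\in P}(A(x)\to e(x,y))$ for all $y\in P$. $D\in L^P$ is directed if $\bigvee_{x\in P}D(x)\ge u$ and $D(x)\otimes D(y)\le\bigvee_{z\in P}D(z)\otimes e(x,z)\otimes e(y,z)$ for all $x,y$. $D\in L^P$ is a lower set if $D(x)\otimes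 e(y,x)\le D(y)$ for all $x,y$; an ideal is a directed lower set; $\mathcal{I}_L(P)$ is the set of ideals. $P$ is an $L$-dcpo if every directed $L$-subset has a supremum. For an $L$-dcpo $P$ and $x\in P$, define $\Downarrow x\in L^P$ by $\Downarrow x(y)=\bigwedge_{I\in\mathcal{I}_L(P)}(e(x,\sqcup I)\to I(y))$. An $L$-dcpo $P$ is a continuous $L$-dcpo if for every $x\in P$, $\Downarrow x$ is directed and $\sqcup\Downarrow x=x$. Closure spaces: a generalized $L$-closure space $(X,\langle\cdot\rangle)$ is a set $X$ with $\langle\cdot\rangle:L^X\to L^X$ such that $\mathrm{sub}(A,B)\le\mathrm{sub}(\langle A\rangle,\langle B\rangle)$ and $\langle\langle A\rangle\rangle\le\langle A\rangle$ for all $A,B\in L^X$. It is interpolative if for all $x,y,a,b\in X$: (IT1) $\bigvee_{t\in X}\langle u_x\rangle(t)\ge u$; (IT2) $\langle u_x\rangle(y)\le\bigvee_{t\in X}\langle u_x\rangle(t)\otimes\langle u_t\rangle(y)$; (IT3) $\langle u_x\rangle(a)\otimes\langle u_x\rangle(b)\le\bigvee_{t\in X}\langle u_x\rangle(t)\otimes\langle u_t\rangle(a)\otimes\langle u_t\rangle(b)$. A directed closed set of an interpolative generalized $L$-closure space is $U\in L^X$ such that for all $x,y\in X$: (DC1) $\bigvee_{x\in X}U(x)\ge u$; (DC2) $U(x)\le\mathrm{sub}(\langle u_x\rangle,U)$; (DC3) $U(x)\le\bigvee_{y\in X}U(y)\otimes\langle u_y\rangle(x)$; (DC4) $U(x)\otimes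 U(y)\le\bigvee_{z\in X}U(z)\otimes\langle u_z\rangle(x)\otimes\langle u_z\rangle(y)$. $\mathfrak{C}(X)$ is the set of all directed closed sets. *)

(* Defs.v *)
From HB Require Import structures.
From mathcomp Require Import all_boot all_order.
From mathcomp Require Import boolp classical_sets.

Set Implicit Arguments.
Unset Strict Implicit.
Unset Printing Implicit Defensive.

Import Order.TTheory.
Local Open Scope classical_set_scope.
Local Open Scope order_scope.

Declare Scope quantale_scope.
Delimit Scope quantale_scope with Q.
Local Open Scope quantale_scope.

HB.mixin Record TBLattice_isComplete d (L : Type) of Order.TBLattice d L := {
  supremums_neq0 : forall A : set L, supremums A !=set0
}.

#[short(type="completeLatticeType")]
HB.structure Definition CompleteLattice d :=
  {L of Order.TBLattice d L & TBLattice_isComplete d L}.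

HB.mixin Record CompleteLattice_isQuantale d (L : Type)
    of CompleteLattice d L := {
  tens : L -> L -> L;
  unitq : L;
  tensA : associative tens;
  tensC : commutative tens;
  tens1q : left_id unitq tens;
  (* [supremum \bot A] is the join of [A], which exists in [L] *)
  tens_sup : forall (a : L) (A : set L),
    tens a (supremum \bot A) = supremum \bot [set tens a x | x in A]
}.

#[short(type="quantaleType")]
HB.structure Definition Quantale d :=
  {L of CompleteLattice d L & CompleteLattice_isQuantale d L}.

Arguments unitq {d L} : rename.

Notation "a ⊗ b" := (tens a b) (at level 40, left associativity)
  : quantale_scope.
Notation "\Sup_ x F" := (supremum \bot (range (fun x => F)))
  (at level 41, x binder, F at level 41) : quantale_scope.
Notation "\Inf_ x F" := (infimum \top (range (fun x => F)))
  (at level 41, x binder, F at level 41) : quantale_scope.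

Section CompleteLatticeTheory.
Context {d : Order.disp_t} {L : completeLatticeType d}.
Implicit Types (A : set L) (a : L).

Lemma supremums_supremum A : supremums A (supremum \bot A).
Proof.
rewrite /supremum; case: eqP => [->|_].
  by split=> [x []|x _]; exact: le0x.
by have [s sA] := supremums_neq0 A; apply: xgetPex; exists s.
Qed.

Lemma sup_ge A a : A a -> a <= supremum \bot A.
Proof. by move=> Aa; have [+ _] := supremums_supremum A; apply. Qed.

Lemma sup_le A a : ubound A a -> supremum \bot A <= a.
Proof. by move=> Aa; have [_ +] := supremums_supremum A; apply. Qed.

Lemma infimums_infimum A : infimums A (infimum \top A).
Proof.
rewrite /infimum; case: eqP => [->|_].
  by split=> [x []|x _]; exact: lex1.
apply: xgetPex; exists (supremum \bot (lbound A)); split=> [x Ax|x Ax].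
  by apply: sup_le => y; apply.
exact: sup_ge.
Qed.

Lemma inf_le A a : A a -> infimum \top A <= a.
Proof. by move=> Aa; have [+ _] := infimums_infimum A; apply. Qed.

Lemma inf_ge A a : lbound A a -> a <= infimum \top A.
Proof. by move=> Aa; have [_ +] := infimums_infimum A; apply. Qed.

End CompleteLatticeTheory.

Section Quantale.
Context {d : Order.disp_t} {L : quantaleType d}.

Definition residual (a b : L) : L := supremum \bot [set c : L | a ⊗ c <= b].
Local Notation "a ⊸ b" := (residual a b) (at level 55, right associativity).

Lemma residualP (a b c : L) : (a ⊗ b <= c) = (b <= a ⊸ c).
Proof.
apply/idP/idP => [|b_le]; first exact: sup_ge.
have tens_mono x y : x <= y -> a ⊗ x <= a ⊗ y.
  move=> xy; have <- : supremum \bot [set x; y] = y.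
    by apply/le_anti/andP; split; [apply: sup_le => _ [->|->]|apply: sup_ge; right].
  by rewrite tens_sup; apply: sup_ge; exists x => //; left.
apply: le_trans (tens_mono _ _ b_le) _.
by rewrite tens_sup; apply: sup_le => _ [x /= ? <-].
Qed.

Section LSubsets.
Context {X : Type}.

Definition lpoint (x : X) : X -> L :=
  fun y => if `[< y = x >] then unitq else \bot.

Definition lsub (A B : X -> L) : L := \Inf_x (A x ⊸ B x).

End LSubsets.

Section LOrders.
Context {P : Type}.
Implicit Types (e : P -> P -> L) (A D I : P -> L).

Definition is_lorder e : Prop :=
  [/\ forall x, unitq <= e x x,
      forall x y z, e x y ⊗ e y z <= e x z
    & forall x y, unitq <= e x y `&` e y x -> x = y].

Definition is_lsup e A (x0 : P) : Prop :=
  forall y, e x0 y = \Inf_x (A x ⊸ e x y).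

Definition directed e D : Prop :=
  unitq <= \Sup_x D x /\
  forall x y, D x ⊗ D y <= \Sup_z (D z ⊗ e x z ⊗ e y z).

Definition lower_set e D : Prop := forall x y, D x ⊗ e y x <= D y.

Definition ideal e I : Prop := directed e I /\ lower_set e I.

Definition is_ldcpo e : Prop :=
  is_lorder e /\ forall D, directed e D -> exists x0, is_lsup e D x0.

(* In an L-dcpo every ideal [I] has exactly one supremum [s], so that this is
   the meet over the ideals [I] of [e x (sup I) ⊸ I y]. *)
Definition way_below e (x : P) : P -> L := fun y =>
  infimum \top [set l | exists I s,
    [/\ ideal e I, is_lsup e I s & l = (e x s ⊸ I y)]].

Definition is_continuous_ldcpo e : Prop :=
  is_ldcpo e /\
  forall x, directed e (way_below e x) /\ is_lsup e (way_below e x) x.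

End LOrders.

Section ClosureSpaces.
Context {X : Type}.
Implicit Type cl : (X -> L) -> (X -> L).

Definition is_gclosure cl : Prop :=
  (forall A B, lsub A B <= lsub (cl A) (cl B)) /\
  (forall A, cl (cl A) <= cl A).

Definition interpolative cl : Prop :=
  [/\ forall x, unitq <= \Sup_t cl (lpoint x) t,
      forall x y,
        cl (lpoint x) y <= \Sup_t (cl (lpoint x) t ⊗ cl (lpoint t) y)
    & forall x a b,
        cl (lpoint x) a ⊗ cl (lpoint x) b <=
        \Sup_t (cl (lpoint x) t ⊗ cl (lpoint t) a ⊗ cl (lpoint t) b)].

Definition directed_closed cl : set (X -> L) := [set U |
  [/\ unitq <= \Sup_x U x,
      forall x, U x <= lsub (cl (lpoint x)) U,
      forall x, U x <= \Sup_y (U y ⊗ cl (lpoint y) x)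
    & forall x y,
        U x ⊗ U y <= \Sup_z (U z ⊗ cl (lpoint z) x ⊗ cl (lpoint z) y)]].

End ClosureSpaces.

Definition sub_order {X : Type} (S : set (X -> L)) : S -> S -> L :=
  fun A B => lsub (val A) (val B).

End Quantale.

Notation "a ⊸ b" := (residual a b) (at level 55, right associativity)
  : quantale_scope.

(* Main.v *)
Require Import Defs.
From HB Require Import structures.
From mathcomp Require Import all_boot all_order.
From mathcomp Require Import boolp classical_sets.

(** Write [k x] for the closure of the point [x].  Since [lsub (lpoint x) A]
    is just [A x], monotonicity and idempotence of the closure turn into
    transitivity: [k x y <= lsub (k y) (k x)].  Together with the
    interpolation axioms this makes every [k x] a directed closed set
    ([directed_closed_hull]), and it makes a directed closed set [U] the join
    of the [k x] weighted by [U x] ([directed_closedE]).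

    Directed suprema of directed closed sets are computed pointwise:
    the weighted union [fun a => \Sup_A (D A ⊗ A a)] satisfies the universal
    property of a supremum in any family of L-subsets that contains it
    ([is_lsup_lunion]), and it is directed closed when [D] is directed
    ([directed_closed_lunion]).  So directed closed sets form an L-dcpo.

    For continuity, consider the degree to which [V] lies inside some [k x]
    with [x] in [U], that is [\Sup_x (U x ⊗ lsub V (k x))].  This is an ideal
    ([ideal_approx]) with supremum [U] ([is_lsup_approx]).  It is
    moreover contained in every ideal [I] whose supremum is above [U]: such a
    supremum is a pointwise union, so a point [x] of [U] already lies in a
    member [A] of [I], whence [k x] is below [A], and so is [V].  Hence it is
    the way-below L-subset of [U] ([way_below_approx]), which is thus directed
    with supremum [U]. *)

Set Implicit Arguments.
Unset Strict Implicit.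
Unset Printing Implicit Defensive.

Import Order.TTheory.

(** * Quantale arithmetic *)

Section QuantaleTheory.
Local Open Scope classical_set_scope.
Local Open Scope order_scope.
Local Open Scope quantale_scope.
Context {d : Order.disp_t} {L : quantaleType d}.
Implicit Types (a b c : L).

(** Makes [AC] permute the factors of iterated tensors. *)
HB.instance Definition _ := Monoid.isComLaw.Build L unitq (@tens d L)
  (@tensA d L) (@tensC d L) (@tens1q d L).

Lemma tensq1 a : a ⊗ unitq = a.
Proof. by rewrite tensC tens1q. Qed.

Lemma le_tens2l a b c : b <= c -> a ⊗ b <= a ⊗ c.
Proof. by move=> bc; rewrite residualP (le_trans bc)// -residualP. Qed.

Lemma le_tens2r a b c : b <= c -> b ⊗ a <= c ⊗ a.
Proof. by rewrite ![_ ⊗ a]tensC; exact: le_tens2l. Qed.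

Lemma le_tens a b c e : a <= b -> c <= e -> a ⊗ c <= b ⊗ e.
Proof. by move=> ab ce; apply: le_trans (le_tens2r _ ab) (le_tens2l _ ce). Qed.

Lemma le_tens_unit a b c : unitq <= b -> a ⊗ b <= c -> a <= c.
Proof. by move=> ub; apply: le_trans; rewrite -[leLHS]tensq1 le_tens2l. Qed.

Lemma tens_residual a b : a ⊗ (a ⊸ b) <= b.
Proof. by rewrite residualP. Qed.

Section Families.
Context {I : Type}.
Implicit Type F : I -> L.

Lemma le_Sup F i a : a <= F i -> a <= \Sup_j F j.
Proof. by move=> /le_trans; apply; apply: sup_ge; exists i. Qed.

Lemma Sup_le F a : (forall i, F i <= a) -> \Sup_j F j <= a.
Proof. by move=> Fa; apply: sup_le => _ [i _ <-]. Qed.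

Lemma tens_Sup_le F a b : (forall i, a ⊗ F i <= b) -> a ⊗ (\Sup_j F j) <= b.
Proof. by move=> Fb; rewrite residualP; apply: Sup_le => i; rewrite -residualP. Qed.

Lemma Sup_tens_le F a b : (forall i, F i ⊗ a <= b) -> (\Sup_j F j) ⊗ a <= b.
Proof. by move=> Fb; rewrite tensC; apply: tens_Sup_le => i; rewrite tensC. Qed.

Lemma le_InfP F a : a <= \Inf_j F j <-> forall i, a <= F i.
Proof.
split=> [aF i|aF]; last by apply: inf_ge => _ [i _ <-].
by apply: le_trans aF _; apply: inf_le; exists i.
Qed.

End Families.

Lemma eq_le a b : (forall c, c <= a <-> c <= b) -> a = b.
Proof. by move=> ab; apply/le_anti/andP; split; apply/ab. Qed.

(** * The inclusion order on L-subsets *)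

Section Inclusion.
Context {X : Type}.
Implicit Types A B C : X -> L.

Lemma le_lsubP A B a : a <= lsub A B <-> forall x, A x ⊗ a <= B x.
Proof.
by rewrite le_InfP; split=> h x; move: (h x); rewrite residualP.
Qed.

Lemma tens_lsub A B x : A x ⊗ lsub A B <= B x.
Proof. by move: x; apply/le_lsubP. Qed.

Lemma lsub_unitP A B : unitq <= lsub A B <-> forall x, A x <= B x.
Proof. by rewrite le_lsubP; split=> h x; move: (h x); rewrite tensq1. Qed.

Lemma lsub_refl A : unitq <= lsub A A.
Proof. exact/lsub_unitP. Qed.

Lemma lsub_trans A B C : lsub A B ⊗ lsub B C <= lsub A C.
Proof.
apply/le_lsubP => x; rewrite tensA.
exact: le_trans (le_tens2r _ (tens_lsub _ _ _)) (tens_lsub _ _ _).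
Qed.

(** A form of the Yoneda lemma: points act by evaluation. *)
Lemma lsub_lpoint x A : lsub (lpoint x) A = A x.
Proof.
apply: eq_le => c; rewrite le_lsubP; split=> [/(_ x)|cA y].
  by rewrite /lpoint asboolT// tens1q.
rewrite /lpoint; case: asboolP => [->|_]; first by rewrite tens1q.
by rewrite tensC residualP le0x.
Qed.

End Inclusion.

(** * Suprema in families of L-subsets *)

Lemma is_lsup_unique (P : Type) (e : P -> P -> L) A x y :
  is_lorder e -> is_lsup e A x -> is_lsup e A y -> x = y.
Proof.
move=> [erefl _ eanti] Ax Ay; apply: eanti; rewrite lexI.
by rewrite [e x y]Ax -Ay erefl [e y x]Ay -Ax erefl.
Qed.

Section SubOrder.
Context {X : Type} (S : set (X -> L)).
Implicit Types (A B : S) (D : S -> L).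

Lemma is_lorder_sub_order : is_lorder (sub_order (S := S)).
Proof.
split=> [A|A B C|A B]; [exact: lsub_refl|exact: lsub_trans|].
rewrite lexI => /andP[/lsub_unitP AB /lsub_unitP BA]; apply: val_inj.
by apply/funext => x; apply/le_anti; rewrite AB BA.
Qed.

Definition lunion D (a : X) : L := \Sup_A (D A ⊗ val A a).

Lemma le_lunion D A (a : X) : D A ⊗ val A a <= lunion D a.
Proof. exact: (le_Sup (i := A)). Qed.

(** Inclusion of the union in [B] is a meet over points of conditions on each
    member; exchanging points and members gives the universal property. *)
Lemma is_lsup_lunion D A : val A = lunion D -> is_lsup (sub_order (S := S)) D A.
Proof.
move=> AE B; apply: eq_le => c; rewrite /sub_order AE le_lsubP le_InfP.
split=> [h C|h a].
  rewrite -residualP le_lsubP => a; apply: le_trans (h a).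
  by rewrite tensA le_tens2r// [val C a ⊗ _]tensC le_lunion.
apply: Sup_tens_le => C; move: (h C); rewrite -residualP le_lsubP => /(_ a).
by rewrite tensA [val C a ⊗ _]tensC.
Qed.

End SubOrder.

(** * Directed closed sets *)

Section DirectedClosed.
Context {X : Type} (cl : (X -> L) -> (X -> L)).
Context (cl_closure : is_gclosure cl).

Let k x := cl (lpoint x).
Local Notation C := (directed_closed cl).
Local Notation sub := (sub_order (S := C)).

(** Transitivity of [k]: by monotonicity [k x y], the inclusion of the point
    [y] in [k x], is below the inclusion of [k y] in the closure of [k x],
    which idempotence shrinks to [k x]. *)
Lemma hull_le_lsub x y : k x y <= lsub (k y) (k x).
Proof.
have [mono idem] := cl_closure.
rewrite -lsub_lpoint; apply: le_trans (mono _ _) _.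
apply: le_tens_unit _ (lsub_trans _ _ _).
by apply/lsub_unitP; exact/lefP/idem.
Qed.

Lemma directed_closed_le_lsub (U : C) x : val U x <= lsub (k x) (val U).
Proof. by case: U => U /= /set_mem[]. Qed.

(** The closure axiom gives one inequality, interpolation the other. *)
Lemma directed_closedE (U : C) (a : X) : val U a = \Sup_x (val U x ⊗ k x a).
Proof.
apply/le_anti/andP; split; first by case: U => U /= /set_mem[].
apply: Sup_le => x; apply: le_trans (le_tens2r _ (directed_closed_le_lsub U x)) _.
by rewrite tensC tens_lsub.
Qed.

(** Each axiom of a directed closed set passes from the members of [D] to the
    union.  Directedness of [D] serves for the axiom on two points [x] and [y]:
    they may lie in different members, and a third member above both contains
    them together. *)
Lemma directed_closed_lunion (D : C -> L) :
  directed sub D -> C (lunion D).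
Proof.
move=> [D1 D2]; split=> [|x|x|x y].
- apply: le_trans D1 _; apply: Sup_le => A.
  have [A1 _ _ _] := set_mem (valP A).
  apply: le_tens_unit A1 _; apply: tens_Sup_le => a.
  by apply: (le_Sup (i := a)); exact: le_lunion.
- apply/le_lsubP => y; rewrite tensC; apply: Sup_tens_le => A.
  apply: le_trans (le_lunion _ A _); rewrite -tensA le_tens2l//.
  by rewrite [leRHS]directed_closedE; exact: (le_Sup (i := x)).
- apply: Sup_le => A; rewrite directed_closedE; apply: tens_Sup_le => y.
  by apply: (le_Sup (i := y)); rewrite tensA le_tens2r// le_lunion.
- apply: Sup_tens_le => A; apply: tens_Sup_le => B.
  rewrite (AC (2*2) ((1*3)*(2*4)))/=.
  apply: le_trans (le_tens2r _ (D2 A B)) _; apply: Sup_tens_le => E.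
  (* A and B are both included in E, so x and y both lie in E. *)
  have -> : D E ⊗ sub A E ⊗ sub B E ⊗ (val A x ⊗ val B y) =
    D E ⊗ ((val A x ⊗ sub A E) ⊗ (val B y ⊗ sub B E)).
    by rewrite (AC (3*2) (1*((4*2)*(5*3)))).
  apply: le_trans (le_tens2l _ (le_tens (tens_lsub _ _ _) (tens_lsub _ _ _))) _.
  have [_ _ _ E4] := set_mem (valP E).
  apply: le_trans (le_tens2l _ (E4 x y)) _; apply: tens_Sup_le => z.
  by apply: (le_Sup (i := z)); rewrite !tensA !le_tens2r// le_lunion.
Qed.

Lemma is_ldcpo_directed_closed : is_ldcpo sub.
Proof.
split=> [|D Ddir]; first exact: is_lorder_sub_order.
exists (SigSub (mem_set (directed_closed_lunion Ddir))).
exact: is_lsup_lunion.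
Qed.

(** By uniqueness of suprema, a supremum given abstractly is the pointwise
    union, so that its values can be computed. *)
Lemma val_lsup (D : C -> L) (A : C) :
  directed sub D -> is_lsup sub D A -> val A = lunion D.
Proof.
move=> Ddir DA; pose B : C := SigSub (mem_set (directed_closed_lunion Ddir)).
suff -> : A = B by [].
by apply: is_lsup_unique DA _; [exact: is_lorder_sub_order|exact: is_lsup_lunion].
Qed.

(** * The way-below relation *)

(** The lower set generated by the L-subset of point closures weighted by
    [U]. *)
Definition approx (U V : C) : L := \Sup_x (val U x ⊗ lsub (val V) (k x)).

(** A point [x] of [U] belongs to the supremum [S] of [I], hence to some member
    [A] of [I]; then [V], being inside [k x], is inside [A]. *)
Lemma approx_le_ideal (U S : C) (I : C -> L) V :
  ideal sub I -> is_lsup sub I S -> sub U S ⊗ approx U V <= I V.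
Proof.
move=> [Idir Ilow] IS; apply: tens_Sup_le => x; rewrite tensA [sub U S ⊗ _]tensC.
apply: le_trans (le_tens2r _ (tens_lsub _ _ _)) _.
rewrite (val_lsup Idir IS); apply: Sup_tens_le => A; rewrite -tensA.
apply: le_trans (Ilow A V); rewrite le_tens2l//.
apply: le_trans (le_tens2r _ (directed_closed_le_lsub A x)) _.
by rewrite tensC lsub_trans.
Qed.

Context (cl_interp : interpolative cl).

(** The interpolation axioms are the axioms of directed closed sets read for
    [k x], except for closedness, which is the transitivity of [k]. *)
Lemma directed_closed_hull x : C (k x).
Proof.
have [it1 it2 it3] := cl_interp.
by split=> [|y|y|a b]; [exact: it1|exact: hull_le_lsub|exact: it2|exact: it3].
Qed.

Let hull x : C := SigSub (mem_set (directed_closed_hull x)).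

Lemma le_approx_hull (U : C) x : val U x <= approx U (hull x).
Proof. by apply: (le_Sup (i := x)); rewrite -[leLHS]tensq1 le_tens2l// lsub_refl. Qed.

(** Closures of points of [U] belong to the family and are cofinal in it, so
    its directedness is that of [U]. *)
Lemma ideal_approx U : ideal sub (approx U).
Proof.
have [U1 _ _ U4] := set_mem (valP U).
split; last first.
  move=> V W; apply: Sup_tens_le => x; apply: (le_Sup (i := x)).
  by rewrite -tensA le_tens2l// tensC lsub_trans.
split=> [|V W].
  by apply: le_trans U1 _; apply: Sup_le => x; apply: (le_Sup (i := hull x));
     exact: le_approx_hull.
apply: Sup_tens_le => x; apply: tens_Sup_le => y.
rewrite (AC (2*2) ((1*3)*(2*4)))/=.
apply: le_trans (le_tens2r _ (U4 x y)) _; apply: Sup_tens_le => z.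
(* A point z of U whose closure contains x and y has a hull above both
   their hulls. *)
apply: (le_Sup (i := hull z)).
rewrite (AC (3*2) (1*(4*2)*(5*3)))/=.
have hullz (A : C) t : lsub (val A) (k t) ⊗ k z t <= sub A (hull z).
  by apply: le_trans (lsub_trans _ (k t) _); rewrite le_tens2l// hull_le_lsub.
by apply: le_tens (le_tens _ (hullz V x)) (hullz W y); exact: le_approx_hull.
Qed.

(** The union of all members is that of the generating point closures, which
    is [U] by [directed_closedE]. *)
Lemma is_lsup_approx U : is_lsup sub (approx U) U.
Proof.
apply: is_lsup_lunion; apply/funext => a; apply/le_anti/andP; split.
  rewrite directed_closedE; apply: Sup_le => x.
  apply: le_trans (le_lunion _ (hull x) a).
  by rewrite le_tens2r// le_approx_hull.
apply: Sup_le => V; apply: Sup_tens_le => x.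
rewrite [leRHS]directed_closedE; apply: (le_Sup (i := x)).
by rewrite -tensA le_tens2l// tensC tens_lsub.
Qed.

(** [approx U] is itself one of the ideals with supremum above [U], and the
    least such. *)
Lemma way_below_approx U : way_below sub U = approx U.
Proof.
apply/funext => V; apply/le_anti/andP; split; last first.
  apply: inf_ge => _ [I [S [Iid IS ->]]]; rewrite -residualP.
  exact: approx_le_ideal.
apply: (@le_trans _ _ (sub U U ⊸ approx U V)).
  by apply: inf_le; exists (approx U), U; split=> //;
    [exact: ideal_approx|exact: is_lsup_approx].
apply: le_tens_unit (lsub_refl (val U)) _; rewrite tensC.
exact: tens_residual.
Qed.

End DirectedClosed.

End QuantaleTheory.

Theorem theorem3p8 (d : Order.disp_t) (L : quantaleType d) (X : Type)
    (cl : (X -> L) -> (X -> L))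
    (cl_closure : is_gclosure cl) (cl_interp : interpolative cl) :
  is_continuous_ldcpo (sub_order (S := directed_closed cl)).
Proof.
split=> [|U]; first exact: is_ldcpo_directed_closed.
rewrite (way_below_approx cl_closure cl_interp); split.
  by have [] := ideal_approx cl_closure cl_interp U.
exact: is_lsup_approx.
Qed.
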